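(* For every $\delta$ with $1/2<\delta\le 1$ there is a constant $C(\delta)>0$ such that the following holds for every $1\le p<\infty$. For infinitely many positive integers $n$ there is an $n$-point metric space $M_n$ such that for every Fréchet embedding $f$ of $M_n$ into $\ell_p$ and every subset $V\subset M_n$ with $|V|\ge n^{\delta}$, $$\mathrm{dist}(f|_V)\ \ge\ (C(\delta)\cdot \log n)^{1/p}.$$
   Context: Let $(X,d)$ be a finite metric space. For $\emptyset\ne A\subset X$ and $x\in X$ put $d(x,A)=\min_{a\in A}d(x,a)$. A map $f$ from $X$ to $\mathbb{R}^{2^X\setminus\{\emptyset\}}$ (real vectors indexed by the nonempty subsets of $X$) is called a Fréchet embedding if for every nonempty $A\subset X$ there is $\alpha_A\in\mathbb{R}$ such that $f(x)=(\alpha_A\, d(x,A))_{A\in 2^X\setminus\{\emptyset\}}$ for all $x\in X$. It is regarded as a Fréchet embedding into $\ell_p$ when the target is equipped with the norm $\|v\|_p=\left(\sum_A |v_A|^p\right)^{1/p}$. (A Fréchet embedding is not required to be injective.) For a map $g:(X,d_X)\to(Y,d_Y)$ between metric spaces, the distortion of $g$ is $$\mathrm{dist}(g)=\sup_{x\neq y}\frac{d_Y(g(x),g(y))}{d_X(x,y)}\cdot \sup_{x\neq y}\frac{d_X(x,y)}{d_Y(g(x),g(y))},$$ with $\mathrm{dist}(g)=\infty$ if $g$ is not injective. For $V\subset X$, $f|_V$ is the restriction of $f$ to $V$, with $V$ carrying the induced metric. *)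

(* Defs.v *)
From HB Require Import structures.
From mathcomp Require Import all_boot all_order all_algebra.
From mathcomp Require Import all_classical all_reals all_analysis.

Set Implicit Arguments.
Unset Strict Implicit.
Unset Printing Implicit Defensive.

Import Order.TTheory GRing.Theory Num.Theory.

Local Open Scope classical_set_scope.
Local Open Scope ring_scope.

#[short(type="finMetricType")]
HB.structure Definition FinMetric (R : numDomainType) :=
  { M of Metric R M & Finite M }.

Section distortion.
Context {R : realType}.

(* The supremum is taken in [0, +oo]: adjoining 0 only matters when T has at
   most one point, where ereal_sup would otherwise return -oo. *)
Definition ratio_sup (T : Type) (num den : T -> T -> R) : \bar R :=
  ereal_sup (0%E |` [set (num xy.1 xy.2 / den xy.1 xy.2)%:E |
                       xy in [set xy : T * T | xy.1 <> xy.2]]).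

(* dX and dY are the distance functions of the source and of the target.
   The case distinction is needed because y / 0 = 0 in a field. *)
Definition distortion (X Y : Type) (dX : X -> X -> R) (dY : Y -> Y -> R)
    (g : X -> Y) : \bar R :=
  if `[< injective g >] then
    (ratio_sup (fun x y => dY (g x) (g y)) dX *
     ratio_sup dX (fun x y => dY (g x) (g y)))%E
  else +oo%E.

Definition lp_norm (I : finType) (p : R) (v : {ffun I -> R}) : R :=
  (\sum_i `|v i| `^ p) `^ p^-1.

Definition lp_dist (I : finType) (p : R) (v w : {ffun I -> R}) : R :=
  lp_norm p (v - w).

End distortion.

Section frechet.
Context {R : realType} (M : finMetricType R).

Definition nonempty_subset : finType := {A : {set M} | A != finset.set0}.

(* For A nonempty this infimum is a minimum, M being finite. *)
Definition set_dist (x : M) (A : {set M}) : R :=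
  inf [set mdist x a | a in [set` A]].

Definition frechet_embedding (f : M -> {ffun nonempty_subset -> R}) : Prop :=
  forall A : nonempty_subset, exists alpha : R,
    forall x : M, f x A = alpha * set_dist x (val A).

Definition induced_dist (V : {set M}) (x y : {x : M | x \in V}) : R :=
  mdist (val x) (val y).

Definition restriction (Y : Type) (f : M -> Y) (V : {set M}) :
    {x : M | x \in V} -> Y := fun x => f (val x).

End frechet.

(* Main.v *)
From HB Require Import structures.
Require Import Defs.
From mathcomp Require Import all_boot all_order all_algebra.
From mathcomp Require Import all_classical all_reals all_analysis.
From mathcomp Require Import ring lra.

(* Let Y be the set of leaves of the binary tree of depth h with a rapidly
   decreasing ultrametric, and attach to every leaf of Y a star with 2^h legs of
   rapidly decreasing lengths: this is the space M, with n = 4^h points.  A set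
   V of n^delta >> sqrt n points contains two points z_i, z'_i (z_i on the
   longer leg) in the star of each i in some S of size about n^(delta - 1/2).
   - If z_i is not in A, then d(z_i, A) - d(z'_i, A) is almost d(z_i, z'_i).
   - Entropy: the branchings of S carry a family P of about h |S| pairs, each
     pair consisting of leaves in the two children of a common node.  For (i, j)
     in P, |d(z_i, A) - d(z_j, A)| is negligible with respect to d(z_i, z_j)
     unless A meets the common node but misses one of the two children.  Along
     a branch this happens at most once, and then no star below the missed
     child has its z_i in A.
   Hence, up to a constant, the P-pairs are together not stretched more than the
   |S| pairs (z_i, z'_i), although there are h times as many of them. *)

Set Implicit Arguments.
Unset Strict Implicit.
Unset Printing Implicit Defensive.

Import Order.TTheory GRing.Theory Num.Theory.

Local Open Scope ring_scope.

(** * Entropy of a splitting into two parts *)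

Lemma ln_entropy_step (R : realType) (kap : R) (a b : nat) :
  0 < kap -> (b <= a)%N ->
  (a + b)%:R * ln (a + b)%:R <=
    a%:R * ln a%:R + b%:R * ln b%:R + (1 + ln kap^-1) * b%:R
    + kap * (a + b)%:R :> R.
Proof.
move=> kap0 ba; have [->|b0] := posnP b.
  by rewrite addn0 mulr0 mul0r !addr0 lerDl mulr_ge0// ltW.
have a0 : (0 < a)%N by exact: leq_trans ba.
have aR : 0 < a%:R :> R by rewrite ltr0n.
have bR : 0 < b%:R :> R by rewrite ltr0n.
have sR : 0 < a%:R + b%:R :> R by rewrite addr_gt0.
rewrite natrD.
have la : a%:R * (ln (a%:R + b%:R) - ln a%:R) <= b%:R :> R.
  rewrite -ln_div ?posrE// mulrDl divff ?gt_eqF// mulrC -ler_pdivlMr//.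
  by apply: le_ln1Dx; rewrite (lt_le_trans (ltrN10 _))// divr_ge0 ?ltW.
(* Applying [ln x < x] to [x = kap (a + b) / b] rather than to [(a + b) / b] brings the term linear
   in [a + b] down to [kap], at the price [ln kap^-1] per unit of [b]. In [matched_pairs], [b]
   counts the pairs gained at a node, and the [kap] term is lost once per height. *)
have lb : b%:R * (ln (a%:R + b%:R) - ln b%:R - ln kap^-1)
          <= kap * (a%:R + b%:R) :> R.
  rewrite lnV ?posrE// opprK -ln_div ?posrE// -lnM ?posrE ?divr_gt0//.
  rewrite mulrC -ler_pdivlMr//.
  apply: le_trans (ltW (ln_sublinear _)) _; first by rewrite mulr_gt0 ?divr_gt0.
  by rewrite mulrC mulrA.
nra.
Qed.

(** * Matching a set into a larger one by zipping enumerations *)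

Section zip_matching.
Context {T : finType}.
Implicit Types Sa Sb U : {set T}.

Lemma mem_zip_enum Sa Sb e :
  e \in zip (enum Sb) (enum Sa) -> (e.1 \in Sb) && (e.2 \in Sa).
Proof.
case: e => x y /=; rewrite -(mem_enum Sb) -(mem_enum Sa).
elim: (enum Sb) (enum Sa) => [|b s IH] [|a t]//=.
rewrite in_cons => /predU1P[[-> ->]|/IH/andP[xs yt]].
  by rewrite !mem_head.
by rewrite !in_cons xs yt !orbT.
Qed.

Lemma size_zip_enum Sa Sb : (#|Sb| <= #|Sa|)%N ->
  size (zip (enum Sb) (enum Sa)) = #|Sb|.
Proof. by move=> ba; rewrite size1_zip -!cardE. Qed.

Lemma sum_mem_enum Sa U : (\sum_(x <- enum Sa) (x \in U) = #|Sa :&: U|)%N.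
Proof.
rewrite big_enum /= -sum1_card big_mkcond [RHS]big_mkcond.
by apply: eq_bigr => x _; rewrite inE; case: (x \in Sa); case: (x \in U).
Qed.

Lemma sum_zip_enum Sa Sb U : (#|Sb| <= #|Sa|)%N ->
  (\sum_(e <- zip (enum Sb) (enum Sa)) ((e.1 \in U) + (e.2 \in U))
   <= #|Sb :&: U| + #|Sa :&: U|)%N.
Proof.
move=> ba; rewrite big_split /=.
rewrite -(big_map fst xpredT (fun x => nat_of_bool (x \in U))).
rewrite -(big_map snd xpredT (fun x => nat_of_bool (x \in U))).
rewrite -/(unzip1 _) -/(unzip2 _) unzip1_zip -?cardE// sum_mem_enum leq_add2l.
rewrite -(sum_mem_enum Sa).
by elim: (enum Sb) (enum Sa) => [|b s IH] [|a t]//=;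
  rewrite ?big_nil// !big_cons leq_add2l.
Qed.

End zip_matching.

(** * Nodes of the binary tree and the family of matched pairs *)

Lemma divn_exp2S (i l : nat) : (i %/ 2 ^ l.+1 = (i %/ 2 ^ l)./2)%N.
Proof. by rewrite expnSr divnMA divn2. Qed.

Lemma divn_exp2_mono (i j l m : nat) : (l <= m)%N ->
  (i %/ 2 ^ l = j %/ 2 ^ l -> i %/ 2 ^ m = j %/ 2 ^ m)%N.
Proof. by move=> /subnKC <-; rewrite expnD !divnMA => ->. Qed.

Section matched_pairs.
Context {R : realType} {n : nat}.
Implicit Types (S T U : {set 'I_n}) (t : 'I_n * 'I_n -> R).

(** The ancestor of leaf [i] at height [l] is encoded by the number [i %/ 2 ^ l], so node [c] at
    height [l.+1] has the children [c.*2] and [c.*2.+1]. *)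
Definition node_hit T l c := [exists i in T, i %/ 2 ^ l == c]%N.

Lemma node_hit_half T l c : node_hit T l c -> node_hit T l.+1 c./2.
Proof.
move=> /exists_inP[i iT /eqP <-]; apply/exists_inP; exists i => //.
by rewrite divn_exp2S.
Qed.

(* T stands for the set of stars met by A, U for the set of i with z_i not in A,
   and t (i, j) for the p-th power of |d(z_i, A) - d(z_j, A)| / d(z_i, z_j). *)
Lemma matched_pairs (kap : R) l : 0 < kap -> forall c S,
  {in S, forall i : 'I_n, i %/ 2 ^ l = c}%N ->
  exists P : seq ('I_n * 'I_n),
  [/\ {in P, forall e, [&& e.1 \in S, e.2 \in S & e.1 != e.2]},
      #|S|%:R * ln #|S|%:R <=
        (1 + ln kap^-1) * (size P)%:R + kap * l%:R * #|S|%:R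
    & forall T U t (eps : R), 0 <= eps -> ~: T \subset U ->
      (forall e, t e <= 1) ->
      (forall m (i j : 'I_n), (i %/ 2 ^ m != j %/ 2 ^ m)%N ->
        (i %/ 2 ^ m.+1 = j %/ 2 ^ m.+1)%N ->
        node_hit T m.+1 (i %/ 2 ^ m.+1)%N ==>
          node_hit T m (i %/ 2 ^ m)%N && node_hit T m (j %/ 2 ^ m)%N ->
        t (i, j) <= eps * ((i \in U) + (j \in U))%:R) ->
      \sum_(e <- P) t e <= (l%:R * eps + (node_hit T l c)%:R) * #|S :&: U|%:R].
Proof.
move=> kap0; elim: l => [|l IH] c S Sc.
  exists [::]; split => //=.
    (* At height 0 a node is a single leaf, so there is no entropy to account for. *)
    have S1 : (#|S| <= 1)%N.
      apply/card_le1P => i iS j; rewrite !inE.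
      apply/idP/eqP => [jS|->//]; apply: val_inj => /=.
      by have := Sc _ jS; rewrite -(Sc _ iS) !divn1.
    by case: #|S| S1 => [|[|]]// _; rewrite ?mul0r ?ln1 !mulr0 ?mul0r addr0.
  move=> T U t eps eps0 _ _ _.
  by rewrite big_nil mulr_ge0// addr_ge0// mul0r.
pose half (b : bool) := [set i in S | odd (i %/ 2 ^ l)%N == b].
have halfP b : {in half b, forall i : 'I_n, i %/ 2 ^ l = c.*2 + b}%N.
  move=> i; rewrite inE => /andP[/Sc + /eqP <-].
  by rewrite divn_exp2S => <-; rewrite addnC odd_double_half.
have [b ba] : exists b, (#|half (~~ b)| <= #|half b|)%N.
  by case: (leqP #|half true| #|half false|) => [|/ltnW];
    [exists false|exists true].
have Sab : S = half b :|: half (~~ b).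
  apply/setP => i; rewrite !inE; case: (i \in S) => //=.
  by case: (odd _); case: (b).
have dab : [disjoint half b & half (~~ b)].
  apply/pred0P => i /=; rewrite !inE; case: (i \in S) => //=.
  by case: (odd _); case: (b).
have cardS U : #|S :&: U| = (#|half b :&: U| + #|half (~~ b) :&: U|)%N.
  have I0 : half b :&: U :&: (half (~~ b) :&: U) = finset.set0.
    apply/setP => i; rewrite !inE; case: (i \in S) => //=.
    by case: (odd _); case: (b); case: (i \in U).
  by rewrite {1}Sab finset.setIUl cardsU I0 cards0 subn0.
have cS : #|S| = (#|half b| + #|half (~~ b)|)%N.
  by have := cardS [set: 'I_n]; rewrite !finset.setIT.
have hS b' i : i \in half b' -> i \in S by rewrite inE => /andP[].
have [Pa [PaS Pa_size Pa_sum]] := IH _ _ (halfP b).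
have [Pb [PbS Pb_size Pb_sum]] := IH _ _ (halfP (~~ b)).
(* The smaller half is matched into the larger one. The number of new pairs, [#|half (~~ b)|], is
   exactly the [b] of [ln_entropy_step]. *)
pose Z := zip (enum (half (~~ b))) (enum (half b)).
exists (Z ++ Pa ++ Pb); split.
- move=> e; rewrite !mem_cat => /or3P[/mem_zip_enum/andP[e1 e2]||].
  + rewrite (hS _ _ e1) (hS _ _ e2) /=; apply: contraTneq e1 => ->.
    by apply/negP => e1; move/pred0P: dab => /(_ e.2)/=; rewrite e1 e2.
  + by move=> /PaS/and3P[/hS -> /hS -> ->].
  + by move=> /PbS/and3P[/hS -> /hS -> ->].
- rewrite cS !size_cat size_zip_enum// !natrD.
  have := ln_entropy_step kap0 ba; rewrite !natrD => H.
  rewrite -[l.+1%:R]natr1; nra.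
- move=> T U t eps eps0 TU t1 teps.
  have /= Pa_le := Pa_sum _ _ _ _ eps0 TU t1 teps.
  have /= Pb_le := Pb_sum _ _ _ _ eps0 TU t1 teps.
  have key1 (b' : bool) : ((c.*2 + b')./2 = c)%N.
    by rewrite addnC half_bit_double.
  have hita := @node_hit_half T l (c.*2 + b); rewrite key1 in hita.
  have hitb := @node_hit_half T l (c.*2 + ~~ b); rewrite key1 in hitb.
  have missU (b' : bool) :
      ~~ node_hit T l (c.*2 + b') -> half b' :&: U = half b'.
    move=> miss; apply/finset.setIidPl; apply: fintype.subset_trans TU.
    apply/fintype.subsetP => i iH; rewrite inE; apply: contra miss => iT.
    by apply/exists_inP; exists i => //; apply/eqP; exact: halfP.
  have Z_small : (node_hit T l.+1 c ==>
      node_hit T l (c.*2 + b) && node_hit T l (c.*2 + ~~ b)) ->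
      \sum_(e <- Z) t e <= eps * #|S :&: U|%:R.
    move=> hit; rewrite cardS addnC; apply: (@le_trans _ _
      (\sum_(e <- Z) (eps * ((e.1 \in U) + (e.2 \in U))%:R))).
      rewrite !big_seq; apply: ler_sum => e /mem_zip_enum/andP[e1 e2].
      have k1 := halfP _ _ e1; have k2 := halfP _ _ e2.
      rewrite {1}(surjective_pairing e); apply: (teps l).
      + by rewrite k1 k2 eqn_add2l; case: (b).
      + by rewrite !divn_exp2S k1 k2 !key1.
      + by rewrite divn_exp2S k1 k2 key1 andbC.
    rewrite -mulr_sumr -natr_sum ler_wpM2l// ler_nat.
    exact: sum_zip_enum.
  (* When the node is hit but one of its children is not, the matching is charged to the missed
     child: by [missU] its whole half lies in [U], and this half is at least as large as [Z]. The
     induction hypothesis for that child carries no [node_hit] term, so the 1 allowed in the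
     conclusion is still available there. *)
  have Z_one : \sum_(e <- Z) t e <= #|half (~~ b)|%:R.
    rewrite -(@size_zip_enum _ (half b))// -sum1_size natr_sum.
    by apply: ler_sum => e _; exact: t1.
  rewrite !big_cat /= [X in _ <= _ * X](_ : _ =
    #|half b :&: U|%:R + #|half (~~ b) :&: U|%:R); last by rewrite cardS natrD.
  move: Z_small; rewrite cardS natrD -[l.+1%:R]natr1.
  have := missU b; have := missU (~~ b).
  set ua := #|half b :&: U|%:R in Pa_le *.
  set ub := #|half (~~ b) :&: U|%:R in Pb_le *.
  have ua0 : 0 <= ua by rewrite ler0n.
  have ub0 : 0 <= ub by rewrite ler0n.
  have baR : #|half (~~ b)|%:R <= #|half b|%:R :> R by rewrite ler_nat.
  case: (node_hit T l (c.*2 + b)) hita Pa_le => [/(_ isT) hit|_] /= Pa_le;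
  case: (node_hit T l (c.*2 + ~~ b)) hitb Pb_le => [/(_ isT) hit'|_] /= Pb_le;
  rewrite ?hit ?hit' /=.
  + by move=> _ _ /(_ isT) Z_le; lra.
  + move=> /(_ isT) Eb _ _; have : ub = #|half (~~ b)|%:R by rewrite /ub Eb.
    nra.
  + move=> _ /(_ isT) Ea _; have : ua = #|half b|%:R by rewrite /ua Ea.
    nra.
  + move=> /(_ isT) Eb _; have : ub = #|half (~~ b)|%:R by rewrite /ub Eb.
    by case: (node_hit T l.+1 c) => /= ubE Z_le; [|have := Z_le isT]; nra.
Qed.

End matched_pairs.

(** * Distance to a set: attainment and the Lipschitz property *)

Section set_dist_theory.
Context {R : realType} {M : finMetricType R}.
Implicit Types (x y a : M) (A : {set M}).

Lemma set_dist_attained x A : A != finset.set0 ->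
  exists2 a, a \in A & set_dist x A = mdist x a.
Proof.
move=> /set0Pn[a0 a0A].
case: (arg_minP (mdist x) a0A) => a aA a_min; exists a => //.
apply/eqP; rewrite eq_le; apply/andP; split.
  apply: ge_inf; last by exists a.
  by exists 0 => _ [b _ <-]; exact: mdist_ge0.
apply: lb_le_inf; first by exists (mdist x a); exists a.
by move=> _ [b bA <-]; exact: a_min.
Qed.

Lemma set_dist_le x A a : a \in A -> set_dist x A <= mdist x a.
Proof.
move=> aA; apply: ge_inf; last by exists a.
by exists 0 => _ [b _ <-]; exact: mdist_ge0.
Qed.

Lemma set_dist_ge0 x A : A != finset.set0 -> 0 <= set_dist x A.
Proof. by move=> /(set_dist_attained x)[a _ ->]; exact: mdist_ge0. Qed.

Lemma set_dist_mem x A : x \in A -> set_dist x A = 0.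
Proof.
move=> xA; apply/eqP; rewrite eq_le set_dist_ge0 ?andbT; last first.
  by apply/set0Pn; exists x.
by rewrite -(mdistxx x) set_dist_le.
Qed.

Lemma set_dist_lipschitz x y A : A != finset.set0 ->
  `|set_dist x A - set_dist y A| <= mdist x y.
Proof.
move=> A0.
have sub u v : set_dist u A - set_dist v A <= mdist u v.
  have [a aA ->] := set_dist_attained v A0.
  by rewrite lerBlDr (le_trans (set_dist_le u aA))// metric_triangle.
by rewrite ler_norml sub andbT lerNl opprB metric_sym.
Qed.

End set_dist_theory.

(** * The ultrametric on the leaves of the tree *)

Section tree_dist.
Context {R : realType}.
Variable h : nat.

(** Consecutive scales differ by the factor [2 h + 1], so that the inner distances of a node are
    smaller by a factor [2 h] than the distances between it and its sibling. An error of order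
    [1 / h] at each of the [h] heights is affordable. *)
Definition tree_base : R := h.*2.+1%:R.

(** The nonzero terms are those below the height at which the ancestors of [i] and [j] merge, so the
    value depends on that height only and is an ultrametric. In the form of a sum, the triangle
    inequality holds term by term. *)
Definition tree_dist (i j : nat) : R :=
  \sum_(m < h) tree_base ^+ m *+ (i %/ 2 ^ m != j %/ 2 ^ m)%N.

Let base_ge0 m : 0 <= tree_base ^+ m.
Proof. by rewrite exprn_ge0// ler0n. Qed.

Lemma tree_dist_ge0 i j : 0 <= tree_dist i j.
Proof. by apply: sumr_ge0 => m _; rewrite mulrn_wge0. Qed.

Lemma tree_distxx i : tree_dist i i = 0.
Proof. by rewrite /tree_dist big1// => m _; rewrite eqxx. Qed.

Lemma tree_dist_sym i j : tree_dist i j = tree_dist j i.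
Proof. by apply: eq_bigr => m _; rewrite eq_sym. Qed.

Lemma tree_dist_triangle j i k :
  tree_dist i k <= tree_dist i j + tree_dist j k.
Proof.
rewrite /tree_dist -big_split; apply: ler_sum => m _ /=.
rewrite -mulrnDr; apply: ler_wpMn2l => //.
have [->//|_] := eqVneq (i %/ _)%N (j %/ _)%N.
by rewrite (leq_trans (leq_b1 _))// leq_addr.
Qed.

Lemma tree_dist_ge (i j m : nat) : (m < h)%N -> (i %/ 2 ^ m != j %/ 2 ^ m)%N ->
  tree_base ^+ m <= tree_dist i j.
Proof.
move=> mh ij; rewrite /tree_dist (bigD1 (Ordinal mh))//= ij lerDl.
by apply: sumr_ge0 => k _; rewrite mulrn_wge0.
Qed.

(** Only scales below [m] contribute, and [tree_base - 1 = 2 h] times their geometric sum is at most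
    [tree_base ^+ m - 1]. *)
Lemma tree_dist_le (i j m : nat) : (m <= h)%N -> (i %/ 2 ^ m = j %/ 2 ^ m)%N ->
  h.*2%:R * tree_dist i j <= tree_base ^+ m.
Proof.
move=> mh ij.
have -> : h.*2%:R = tree_base - 1 by rewrite /tree_base -natr1 addrK.
rewrite (@le_trans _ _ (tree_base ^+ m - 1))//; last by rewrite gerBl.
rewrite subrX1 ler_wpM2l// ?subr_ge0 ?ler1n//.
rewrite (big_ord_widen h (fun k => tree_base ^+ k) mh).
rewrite [X in _ <= X]big_mkcond; apply: ler_sum => k _.
case: ltnP => [_|mk]; first by case: (_ != _) => //=; rewrite mulr0n.
by rewrite (divn_exp2_mono mk ij) eqxx.
Qed.

(** Up to height [m] the leaf [a] is separated from both [i] and [j]; from height [m] on, [i] and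
    [j] have the same ancestors. *)
Lemma tree_dist_outer (i j a m : nat) :
  (i %/ 2 ^ m = j %/ 2 ^ m)%N -> (a %/ 2 ^ m != i %/ 2 ^ m)%N ->
  tree_dist i a = tree_dist j a.
Proof.
move=> ij ai; apply: eq_bigr => k _.
have [km|/ltnW mk] := leqP k m; last by rewrite (divn_exp2_mono mk ij).
congr (_ *+ nat_of_bool _); apply/idP/idP => _.
  by apply: contra ai => /eqP/(divn_exp2_mono km); rewrite ij => ->.
by apply: contra ai => /eqP/(divn_exp2_mono km) ->.
Qed.

End tree_dist.

(** * The metric space: a star attached to every leaf *)

Section broom.
Context {R : realType}.

(* [gam_gt0] is a parameter so that the metric structure can be inferred. *)
Definition broom (h : nat) (gam : R) (gam_gt0 : 0 < gam) : Type :=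
  ('I_(2 ^ h) * 'I_(2 ^ h))%type.

Variables (h : nat) (gam : R) (gam_gt0 : 0 < gam).

HB.instance Definition _ :=
  Finite.copy (broom h gam_gt0) ('I_(2 ^ h) * 'I_(2 ^ h))%type.

(** The exponent starts at 1, so that for [gam <= 1] even the longest leg is at most [gam], to be
    compared with tree distances of at least 1. *)
Definition leg (s : nat) : R := gam ^+ s.+1.

Lemma leg_gt0 s : 0 < leg s.
Proof. exact: exprn_gt0. Qed.

(** The point [(i, s)] is the free end of leg [s] of the star at leaf [i]; the centres of the stars
    are not points of the space. *)
Definition broom_dist (x y : broom h gam_gt0) : R :=
  if x == y then 0 else tree_dist h x.1 y.1 + leg x.2 + leg y.2.

Let broom_distxx x : broom_dist x x = 0.
Proof. by rewrite /broom_dist eqxx. Qed.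

Lemma broom_dist_neq x y : x != y ->
  broom_dist x y = tree_dist h x.1 y.1 + leg x.2 + leg y.2.
Proof. by rewrite /broom_dist => /negbTE ->. Qed.

Let broom_dist_gt0 x y : x != y -> 0 < broom_dist x y.
Proof.
move=> xy; rewrite broom_dist_neq//.
have := @tree_dist_ge0 R h x.1 y.1; have := leg_gt0 x.2; have := leg_gt0 y.2.
lra.
Qed.

Let broom_dist_positivity x y : broom_dist x y = 0 -> x = y.
Proof.
by have [//|/broom_dist_gt0 + xy] := eqVneq x y; rewrite xy ltxx.
Qed.

Let broom_dist_sym x y : broom_dist x y = broom_dist y x.
Proof. by rewrite /broom_dist eq_sym tree_dist_sym addrAC. Qed.

Let broom_dist_triangle y x z :
  broom_dist x z <= broom_dist x y + broom_dist y z.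
Proof.
have [->|xy] := eqVneq x y; first by rewrite broom_distxx add0r.
have [->|yz] := eqVneq y z; first by rewrite broom_distxx addr0.
have [->|xz] := eqVneq x z.
  by rewrite broom_distxx addr_ge0// ltW// broom_dist_gt0// eq_sym// -(eqP xz).
rewrite !broom_dist_neq//.
have := @tree_dist_triangle R h y.1 x.1 z.1; have := leg_gt0 y.2.
lra.
Qed.

HB.instance Definition _ := @isMetric.Build R (broom h gam_gt0) broom_dist
  broom_distxx broom_dist_positivity broom_dist_sym broom_dist_triangle.

Lemma card_broom : #|{: broom h gam_gt0}| = (2 ^ h * 2 ^ h)%N.
Proof. by rewrite card_prod !card_ord. Qed.

End broom.

(** * Quotients of the distance to a set, and their estimates in the broom *)

Definition dist_quotient {R : realType} {M : finMetricType R} (A : {set M})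
  (x y : M) : R := `|set_dist x A - set_dist y A| / mdist x y.

Lemma dist_quotient_ge0 {R : realType} {M : finMetricType R} (A : {set M})
  (x y : M) : 0 <= dist_quotient A x y.
Proof. by rewrite divr_ge0// mdist_ge0. Qed.

Lemma dist_quotient_le1 {R : realType} {M : finMetricType R} (A : {set M})
  (x y : M) : A != finset.set0 -> dist_quotient A x y <= 1.
Proof.
move=> A0; have [->|xy] := eqVneq x y.
  by rewrite /dist_quotient mdistxx invr0 mulr0.
by rewrite ler_pdivrMr ?mdist_gt0// mul1r set_dist_lipschitz.
Qed.

Section broom_estimates.
Context {R : realType}.
Variables (h : nat) (gam : R) (gam_gt0 : 0 < gam).
Hypotheses (h0 : (0 < h)%N) (gam_small : 4 * h%:R * gam <= 1).
Let M : finMetricType R := broom h gam_gt0.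
Implicit Types (x y : M) (A : {set M}).

Let h1 : 1 <= h%:R :> R.
Proof. by rewrite ler1n. Qed.

Let gam_lt1 : gam < 1.
Proof. by have hg := ler_wpM2r (ltW gam_gt0) h1; move: gam_small; lra. Qed.

Lemma leg_le s : leg gam s <= gam.
Proof.
rewrite /leg exprS; apply: ler_piMr; first exact: ltW.
by apply: exprn_ile1; exact: ltW.
Qed.

Lemma leg_decay (s s' : nat) : (s < s')%N ->
  leg gam s' <= gam * leg gam s.
Proof.
by move=> ss; rewrite /leg -exprS ler_wiXn2l ?ltW.
Qed.

Lemma broom_mdist_neq x y : x != y ->
  mdist x y = tree_dist h x.1 y.1 + leg gam x.2 + leg gam y.2.
Proof. exact: broom_dist_neq. Qed.

(** A point of [A] below the same node is within [tree_base ^+ m / (2 h)] in the tree, and the two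
    legs add at most [2 gam <= 1 / (2 h)]. *)
Lemma broom_set_dist_node A x m : (m <= h)%N -> A != finset.set0 ->
  node_hit [set a.1 | a in A] m (x.1 %/ 2 ^ m)%N ->
  h%:R * set_dist x A <= tree_base h ^+ m.
Proof.
move=> mh A0 /exists_inP[_ /imsetP[a aA ->] /eqP ax].
have B1 : 1 <= tree_base h ^+ m :> R by rewrite exprn_ege1// ler1n.
apply: (@le_trans _ _ (h%:R * mdist x a)).
  by rewrite ler_wpM2l// set_dist_le.
have [->|xa] := eqVneq x a; first by rewrite mdistxx mulr0 (le_trans ler01).
rewrite broom_mdist_neq//.
have := @tree_dist_le R h _ _ _ mh (esym ax).
have lx := ler_wpM2l (ler0n R h) (leg_le x.2).
have la := ler_wpM2l (ler0n R h) (leg_le a.2).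
rewrite -mul2n natrM; move: gam_small; lra.
Qed.

(** Here [mdist x y] is at least [tree_base ^+ m]. If both children are hit, each of the two
    distances to [A] is at most a fraction [1 / h] of this. If the parent is missed, every point of
    [A] is equally far from [x] and [y] up to the legs, so the two distances differ by at most
    [gam]. *)
Lemma broom_quotient_small A x y m : A != finset.set0 ->
  (x.1 %/ 2 ^ m != y.1 %/ 2 ^ m)%N ->
  (x.1 %/ 2 ^ m.+1 = y.1 %/ 2 ^ m.+1)%N ->
  (node_hit [set a.1 | a in A] m.+1 (x.1 %/ 2 ^ m.+1)%N ==>
    node_hit [set a.1 | a in A] m (x.1 %/ 2 ^ m)%N
    && node_hit [set a.1 | a in A] m (y.1 %/ 2 ^ m)%N) ->
  dist_quotient A x y <= h%:R^-1.
Proof.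
move=> A0 xy_m xy_m1.
have mh : (m < h)%N.
  rewrite ltnNge; apply: contra xy_m => hm; apply/eqP/(divn_exp2_mono hm).
  by rewrite !divn_small.
have xy : x != y by apply: contra_neq xy_m => ->.
have hR : 0 < h%:R :> R by rewrite ltr0n.
rewrite /dist_quotient ler_pdivrMr ?mdist_gt0// mulrC ler_pdivlMr// mulrC.
have dxy : tree_base h ^+ m <= mdist x y :> R.
  rewrite broom_mdist_neq// -addrA ler_wpDr ?tree_dist_ge//.
  by rewrite addr_ge0// ltW// leg_gt0.
case: (boolP (node_hit _ m.+1 _)) => [_ /= /andP[hx hy]|miss _].
  have := broom_set_dist_node (ltnW mh) A0 hx.
  have := broom_set_dist_node (ltnW mh) A0 hy.
  have := mulr_ge0 (ler0n R h) (set_dist_ge0 x A0).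
  have := mulr_ge0 (ler0n R h) (set_dist_ge0 y A0).
  by case: (ger0P (set_dist x A - set_dist y A)); lra.
have outer a : a \in A -> (a.1 %/ 2 ^ m.+1 != x.1 %/ 2 ^ m.+1)%N.
  move=> aA; apply: contra miss => ax; apply/exists_inP; exists a.1 => //.
  exact: imset_f.
have set_dist_sub_le (u v : M) : (u.1 %/ 2 ^ m.+1 = x.1 %/ 2 ^ m.+1)%N ->
    (v.1 %/ 2 ^ m.+1 = x.1 %/ 2 ^ m.+1)%N ->
    set_dist u A - set_dist v A <= gam.
  move=> ux vx; have [a aA ->] := set_dist_attained v A0.
  have ua : u != a by apply: contraNneq (outer _ aA) => <-; rewrite ux.
  have va : v != a by apply: contraNneq (outer _ aA) => <-; rewrite vx.
  have := set_dist_le u aA; rewrite !broom_mdist_neq//.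
  have -> : tree_dist h u.1 a.1 = tree_dist h v.1 a.1 :> R.
    by apply: (@tree_dist_outer _ _ _ _ _ m.+1); rewrite ux ?vx// outer.
  have := leg_le u.2; have := leg_gt0 gam_gt0 v.2; lra.
have B1 : 1 <= tree_base h ^+ m :> R by rewrite exprn_ege1// ler1n.
have gh := gam_small.
have := ler_wpM2l (ler0n R h) (set_dist_sub_le x y erefl (esym xy_m1)).
have := ler_wpM2l (ler0n R h) (set_dist_sub_le y x (esym xy_m1) erefl).
by case: (ger0P (set_dist x A - set_dist y A)); lra.
Qed.

(** Every path leaving the longer leg [s] runs through the centre of the star, so a point of [A] off
    this star pair is farther from [(i, s)] than from [(i, s')] by the difference of the legs; if
    [(i, s')] itself is nearest, the gap is even their sum. The legs decay by a factor [gam]. *)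
Lemma broom_quotient_fibre A (i s s' : 'I_(2 ^ h)) : (s < s')%N ->
  A != finset.set0 -> ((i, s) : M) \notin A ->
  (1 - gam) / (1 + gam) <= dist_quotient A ((i, s) : M) (i, s').
Proof.
move=> ss A0; set z : M := (i, s); set z' : M := (i, s') => zA.
have zz' : z != z' by apply: contraTneq ss => -[->]; rewrite ltnn.
have legs := leg_decay ss.
have l0 := leg_gt0 gam_gt0 s; have l1 := leg_gt0 gam_gt0 s'.
have dzz' : mdist z z' = leg gam s + leg gam s'.
  by rewrite broom_mdist_neq//= tree_distxx add0r.
have gap : leg gam s - leg gam s' <= set_dist z A - set_dist z' A.
  have [a aA ->] := set_dist_attained z A0.
  have za : z != a by apply: contraNneq zA => ->.
  have [az'|z'a] := eqVneq z' a.
    by rewrite -az' in aA *; rewrite dzz' (set_dist_mem aA); lra.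
  have := set_dist_le z' aA.
  by rewrite !broom_mdist_neq//=; lra.
rewrite /dist_quotient dzz' ler_pdivlMr ?addr_gt0// mulrAC.
rewrite ler_pdivrMr ?addr_gt0//.
have := ler_norm (set_dist z A - set_dist z' A).
move=> *; nra.
Qed.

End broom_estimates.

(** * Stretch of a Fréchet embedding, and lower bounds for distortion *)

Lemma lp_norm_powR {R : realType} (I : finType) (p : R) (v : {ffun I -> R}) :
  p != 0 -> lp_norm p v `^ p = \sum_i `|v i| `^ p.
Proof.
move=> p0; rewrite /lp_norm -powRrM mulVf// powRr1//.
by apply: sumr_ge0 => i _; exact: powR_ge0.
Qed.

Lemma lp_norm_gt0 {R : realType} (I : finType) (p : R) (v : {ffun I -> R}) :
  v != 0 -> 0 < lp_norm p v.
Proof.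
move=> v0; apply: powR_gt0.
have [i vi] : exists i, v i != 0.
  apply/existsP; apply: contraNT v0 => /existsPn v0; apply/eqP/ffunP => i.
  by rewrite ffunE; apply/eqP/negPn/v0.
rewrite (bigD1 i)//= ltr_wpDr//.
  by apply: sumr_ge0 => j _; exact: powR_ge0.
by rewrite powR_gt0// normr_gt0.
Qed.

(** The weights [|alpha_A|^p] do not depend on the pair of points. Hence a linear inequality between
    p-th powers of stretches follows once it is known for each set [A] separately. *)
Lemma frechet_lp_dist_powR {R : realType} {M : finMetricType R} (p : R)
    (f : M -> {ffun nonempty_subset M -> R}) :
  0 < p -> frechet_embedding f ->
  exists2 w : nonempty_subset M -> R, (forall A, 0 <= w A) &
    forall x y, (lp_dist p (f x) (f y) / mdist x y) `^ p =
      \sum_A w A * dist_quotient (val A) x y `^ p.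
Proof.
move=> p0 /choice[alpha f_eq]; exists (fun A => `|alpha A| `^ p).
  by move=> A; exact: powR_ge0.
move=> x y; rewrite powRM ?invr_ge0 ?mdist_ge0 ?powR_ge0//.
rewrite lp_norm_powR ?gt_eqF// mulr_suml; apply: eq_bigr => A _.
rewrite !ffunE !f_eq -mulrBr normrM /dist_quotient.
by rewrite !powRM ?mulr_ge0 ?invr_ge0 ?mdist_ge0// mulrA.
Qed.

(** For injective [g], the first supremum is tested at [(u, v)] and the second at [(x, y)];
    otherwise the distortion is infinite. *)
Lemma distortion_ge {R : realType} (X Y : Type) (dX : X -> X -> R)
    (dY : Y -> Y -> R) (g : X -> Y) (c : R) (x y u v : X) :
  x <> y -> u <> v -> 0 < dX x y -> 0 <= dY (g u) (g v) / dX u v ->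
  (g x <> g y -> 0 < dY (g x) (g y)) ->
  c * (dY (g x) (g y) / dX x y) <= dY (g u) (g v) / dX u v ->
  (c%:E <= distortion dX dY g)%E.
Proof.
move=> xy uv dxy duv dgxy cle; rewrite /distortion.
case: asboolP => [g_inj|_]; last exact: leey.
have {}dgxy : 0 < dY (g x) (g y) by apply: dgxy => /g_inj.
apply: (@le_trans _ _ ((dY (g u) (g v) / dX u v)%:E *
                       (dX x y / dY (g x) (g y))%:E)%E).
  by rewrite -EFinM lee_fin -ler_pdivrMr ?divr_gt0// invf_div.
apply: lee_pmul; rewrite ?lee_fin//; first by rewrite divr_ge0// ltW.
  by apply: ereal_sup_ubound; right; exists (u, v).
by apply: ereal_sup_ubound; right; exists (x, y).
Qed.

(** Averaging: take the least [F i] and the greatest [G j]. *)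
Lemma exists_le_of_sum_le {R : realType} (I J : eqType) (s : seq I) (t : seq J)
    (F : I -> R) (G : J -> R) :
  s != [::] -> t != [::] -> \sum_(i <- s) F i <= \sum_(j <- t) G j ->
  exists i j, [/\ i \in s, j \in t & (size s)%:R * F i <= (size t)%:R * G j].
Proof.
case: s => // i0 s _; case: t => // j0 t _ FG.
have [i is_ i_min] : exists2 i, i \in i0 :: s &
    forall k, k \in i0 :: s -> F i <= F k.
  elim: s i0 {FG} => [|i1 s IH] i0.
    by exists i0 => [|k]; rewrite ?mem_head// inE => /eqP ->.
  have [i is_ i_min] := IH i1; have [ii|ii] := leP (F i) (F i0).
    by exists i => [|k]; rewrite inE ?is_ ?orbT// => /predU1P[-> //|/i_min].
  exists i0 => [|k]; rewrite ?mem_head// inE => /predU1P[->//|/i_min].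
  by apply: le_trans; exact: ltW.
have [j jt j_max] : exists2 j, j \in j0 :: t &
    forall k, k \in j0 :: t -> G k <= G j.
  elim: t j0 {FG} => [|j1 t IH] j0.
    by exists j0 => [|k]; rewrite ?mem_head// inE => /eqP ->.
  have [j jt j_max] := IH j1; have [jj|jj] := leP (G j0) (G j).
    by exists j => [|k]; rewrite inE ?jt ?orbT// => /predU1P[-> //|/j_max].
  exists j0 => [|k]; rewrite ?mem_head// inE => /predU1P[->//|/j_max].
  by move=> kj; rewrite (le_trans kj)// ltW.
exists i, j; split => //.
have constE (T : eqType) (r : seq T) (x : R) :
    (size r)%:R * x = \sum_(k <- r) x.
  rewrite -sum1_size natr_sum mulr_suml.
  by apply: eq_bigr => k _; rewrite mul1r.
rewrite !constE; apply: le_trans (le_trans FG _); rewrite !big_seq.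
  by apply: ler_sum => k; exact: i_min.
by apply: ler_sum => k; exact: j_max.
Qed.

(** * Stars containing at least two points of a set *)

Section large_fibres.
Context {m n : nat}.
Implicit Type V : {set 'I_m * 'I_n}.

Definition fibre V i := [set s | (i, s) \in V].

Definition large_fibres V := [set i | 1 < #|fibre V i|]%N.

(** The fibres with at most one point contribute at most [m] together, each of the others at most
    [n]. *)
Lemma card_large_fibres V : (#|V| <= m + #|large_fibres V| * n)%N.
Proof.
have -> : (#|V| = \sum_i #|fibre V i|)%N.
  have fibreE i : (#|fibre V i| = \sum_s ((i, s) \in V))%N.
    rewrite -sum1_card big_mkcond; apply: eq_bigr => s _.
    by rewrite inE; case: ifP.
  under [RHS]eq_bigr do rewrite fibreE.
  rewrite pair_bigA -sum1_card big_mkcond; apply: eq_bigr => -[i s] _ /=.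
  by case: ifP.
have -> : (m + #|large_fibres V| * n =
           \sum_(i < m) (1 + (i \in large_fibres V) * n))%N.
  rewrite big_split /= sum1_card card_ord -sum1_card -big_distrl /=.
  by congr (_ + _ * _)%N; rewrite big_mkcond; apply: eq_bigr => i _; case: ifP.
apply: leq_sum => i _; rewrite inE; case: (ltnP 1 _) => // _.
by rewrite mul1n (leq_trans (max_card _))// card_ord leq_addl.
Qed.

Lemma large_fibres_pair V : (0 < n)%N -> exists s1 s2 : 'I_m -> 'I_n,
  {in large_fibres V, forall i,
    [/\ (s1 i < s2 i)%N, (i, s1 i) \in V & (i, s2 i) \in V]}.
Proof.
move=> n0.
have /choice[s12 s12P] (i : 'I_m) : exists st : 'I_n * 'I_n,
    i \in large_fibres V ->
    [/\ (st.1 < st.2)%N, (i, st.1) \in V & (i, st.2) \in V].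
  have [|_] := boolP (i \in large_fibres V); last first.
    by exists (Ordinal n0, Ordinal n0).
  rewrite inE => /card_gt1P[s [t]]; rewrite !inE => -[sV tV].
  rewrite neq_ltn => /orP[st|ts]; [by exists (s, t)|by exists (t, s)].
by exists (fun i => (s12 i).1), (fun i => (s12 i).2).
Qed.

End large_fibres.

(** * Distortion on subsets of the broom, and choice of the parameters *)

Lemma broom_distortion_ge {R : realType} (p gam : R) (gam_gt0 : 0 < gam)
    (h : nat) (kap : R) :
  1 <= p -> (0 < h)%N -> 4 * h%:R * gam <= 1 ->
  2^-1 <= ((1 - gam) / (1 + gam)) `^ p -> 0 < kap < 1 ->
  forall f : broom h gam_gt0 -> {ffun nonempty_subset (broom h gam_gt0) -> R},
  frechet_embedding f ->
  forall (V : {set broom h gam_gt0}) (k : R), 0 <= k ->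
  kap * h%:R < ln #|large_fibres V|%:R ->
  (1 + ln kap^-1) * (4 * k) <= ln #|large_fibres V|%:R - kap * h%:R ->
  ((k `^ p^-1)%:E <= distortion (@induced_dist R (broom h gam_gt0) V)
     (lp_dist p) (restriction f (V := V)))%E.
Proof.
move=> p1 h0 gam_small gam_half /andP[kap0 kap1] f f_frechet V k k0 lnN kle.
set S := large_fibres V in lnN kle *.
have p0 : 0 < p by rewrite (lt_le_trans ltr01).
have hR : 0 < h%:R :> R by rewrite ltr0n.
have N0 : 0 < #|S|%:R :> R.
  rewrite ltr0n lt0n; apply: contraTN lnN => /eqP ->.
  by rewrite -leNgt ln0// mulr_ge0 ?ltW.
have [s1 [s2 s12P]] := large_fibres_pair V (expn_gt0 2 h).
pose z (i : 'I_(2 ^ h)) : broom h gam_gt0 := (i, s1 i).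
pose z' (i : 'I_(2 ^ h)) : broom h gam_gt0 := (i, s2 i).
have Snode : {in S, forall i : 'I_(2 ^ h), (i %/ 2 ^ h = 0)%N}.
  by move=> i _; rewrite divn_small.
have [P [PS P_size P_sum]] := matched_pairs kap0 Snode.
(* Without pairs the entropy bound would give [ln #|S| <= kap * h]. *)
have P0 : P != [::].
  apply: contraTneq lnN => P0; rewrite -leNgt.
  by rewrite -(ler_pM2l N0) (le_trans P_size)// P0 mulr0 add0r mulrC.
have [w w0 ratioE] := frechet_lp_dist_powR p0 f_frechet.
pose r x y := lp_dist p (f x) (f y) / mdist x y.
(* It suffices to compare the two sums for one set [B] at a time. The factor 4 is a product of two:
   [h * h^-1 + 1 <= 2] from [matched_pairs] with [eps = h^-1], and 2 from [gam_half]. *)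
have r_sum : \sum_(e <- P) r (z e.1) (z e.2) `^ p <=
    \sum_(i <- enum S) 4 * r (z i) (z' i) `^ p.
  under eq_bigr do rewrite ratioE.
  under [X in _ <= X]eq_bigr do rewrite ratioE mulr_sumr.
  rewrite exchange_big [X in _ <= X]exchange_big; apply: ler_sum => A _ /=.
  rewrite -mulr_sumr; under [X in _ <= X]eq_bigr do rewrite mulrCA.
  rewrite -mulr_sumr ler_wpM2l//; case: A => B /= B0.
  pose T : {set 'I_(2 ^ h)} := [set a.1 | a in B].
  pose U := [set i | z i \notin B].
  pose t (e : 'I_(2 ^ h) * 'I_(2 ^ h)) := dist_quotient B (z e.1) (z e.2) `^ p.
  (* Quotients are at most 1 and [p >= 1], so the bound [h^-1] passes to p-th powers with no
     dependence on [p]. *)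
  have t_le e : t e <= dist_quotient B (z e.1) (z e.2).
    have [q0|q0] := ltP 0 (dist_quotient B (z e.1) (z e.2)).
      by rewrite ge1r_powR// q0 dist_quotient_le1.
    rewrite /t; have -> : dist_quotient B (z e.1) (z e.2) = 0.
      by apply/eqP; rewrite eq_le q0 dist_quotient_ge0.
    by rewrite powR0// gt_eqF.
  have TU : ~: T \subset U.
    apply/fintype.subsetP => i; rewrite !inE; apply: contra => zB.
    by apply/imsetP; exists (z i).
  have t1 e : t e <= 1 by rewrite (le_trans (t_le e))// dist_quotient_le1.
  have eps0 : 0 <= h%:R^-1 :> R by rewrite invr_ge0 ltW.
  have t_eps l (i j : 'I_(2 ^ h)) : (i %/ 2 ^ l != j %/ 2 ^ l)%N ->
      (i %/ 2 ^ l.+1 = j %/ 2 ^ l.+1)%N ->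
      node_hit T l.+1 (i %/ 2 ^ l.+1)%N ==>
        node_hit T l (i %/ 2 ^ l)%N && node_hit T l (j %/ 2 ^ l)%N ->
      t (i, j) <= h%:R^-1 * ((i \in U) + (j \in U))%:R.
    move=> ij_l ij_l1 hit; have q_le := @broom_quotient_small R h gam gam_gt0
      h0 gam_small B (z i) (z j) l B0 ij_l ij_l1 hit.
    have t_h : t (i, j) <= h%:R^-1 by rewrite (le_trans (t_le _)).
    (* If [z i] and [z j] both lie in [B], both distances vanish; otherwise the factor counting
       membership in [U] is at least 1. *)
    rewrite !inE; case: (boolP (z i \in B)) => zi;
      case: (boolP (z j \in B)) => zj /=.
    - rewrite (le_trans (t_le _))// mulr0 /dist_quotient !set_dist_mem//.
      by rewrite subrr normr0 mul0r.
    - by rewrite mulr1.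
    - by rewrite mulr1.
    - by rewrite (le_trans t_h)// ler_peMr// ler1n.
  apply: le_trans (P_sum _ _ _ _ eps0 TU t1 t_eps) _.
  apply: (@le_trans _ _ (2 * #|S :&: U|%:R)).
    by rewrite ler_wpM2r// mulfV ?gt_eqF// lerD2l lern1 leq_b1.
  rewrite -sum1_card natr_sum mulr_sumr big_enum /= [X in X <= _]big_mkcond.
  rewrite [X in _ <= X]big_mkcond; apply: ler_sum => i _ /=.
  rewrite finset.in_setI [i \in U]inE; case: (boolP (i \in S)) => //= iS.
  case: (boolP (z i \in B)) => [_|ziB] /=; first by rewrite mulr_ge0 ?powR_ge0.
  have [ss _ _] := s12P _ iS.
  have q_ge := @broom_quotient_fibre R h gam gam_gt0 h0 gam_small B
    i _ _ ss B0 ziB.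
  have : 2^-1 <= dist_quotient B (z i) (z' i) `^ p.
    apply: le_trans gam_half _.
    apply: ge0_ler_powR => //; rewrite ?nnegrE ?(ltW p0) ?dist_quotient_ge0//.
    have gam_le1 : gam <= 1.
      have := ler_wpM2r (ltW gam_gt0) (_ : 1 <= h%:R); rewrite ler1n => /(_ h0).
      lra.
    by rewrite divr_ge0 ?subr_ge0// addr_ge0// ltW.
  lra.
have S0 : enum S != [::] by rewrite -size_eq0 -cardE -lt0n -(@ltr0n R).
have [e [i [eP iS r_le]]] := exists_le_of_sum_le P0 S0 r_sum.
have /and3P[e1S e2S e12] := PS _ eP.
rewrite mem_enum in iS; rewrite -cardE in r_le.
have [_ x1V _] := s12P _ e1S; have [_ x2V _] := s12P _ e2S.
have [s12 uV vV] := s12P _ iS.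
have zneq : z e.1 != z e.2 by apply: contra_neq e12 => -[].
have z'neq : z i != z' i by apply: contraTneq s12 => -[->]; rewrite ltnn.
(* The entropy bound reads [#|S| (ln #|S| - kap h) <= (1 + ln kap^-1) #|P|], so the pairs of [P]
   outnumber [S] by a factor of at least [4 k]. *)
have k_le : k <= (size P)%:R / (4 * #|S|%:R).
  have lam0 : 0 < 1 + ln kap^-1 by rewrite addr_gt0// ln_gt0// invf_gt1.
  rewrite ler_pdivlMr ?mulr_gt0// -(ler_pM2l lam0).
  have := ler_wpM2l (ltW N0) kle; move: P_size; lra.
pose x1 : {x | x \in V} := exist _ (z e.1) x1V.
pose x2 : {x | x \in V} := exist _ (z e.2) x2V.
pose u : {x | x \in V} := exist _ (z i) uV.
pose v : {x | x \in V} := exist _ (z' i) vV.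
have r_ge0 x y : 0 <= r x y.
  by rewrite divr_ge0 ?mdist_ge0// /lp_dist /lp_norm powR_ge0.
have quotients_le : k `^ p^-1 * r (z e.1) (z e.2) <= r (z i) (z' i).
  have powRK y : 0 <= y -> (y `^ p) `^ p^-1 = y.
    by move=> y0; rewrite -powRrM mulfV ?gt_eqF// powRr1.
  rewrite -[X in _ * X <= _](powRK _ (r_ge0 _ _)) -powRM ?powR_ge0//.
  rewrite -[X in _ <= X](powRK _ (r_ge0 _ _)).
  apply: ge0_ler_powR;
    rewrite ?nnegrE ?mulr_ge0 ?powR_ge0 ?invr_ge0 ?(ltW p0)//.
  apply: le_trans (ler_wpM2r (powR_ge0 _ _) k_le) _.
  rewrite mulrAC ler_pdivrMr ?mulr_gt0//; move: r_le; lra.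
apply: (@distortion_ge R _ _ _ _ _ _ x1 x2 u v).
- by move=> /(congr1 val)/eqP; rewrite (negbTE zneq).
- by move=> /(congr1 val)/eqP; rewrite (negbTE z'neq).
- by rewrite mdist_gt0.
- exact: r_ge0.
- by move=> /eqP fz; rewrite lp_norm_gt0// subr_eq0.
- exact: quotients_le.
Qed.

Theorem theorem2 (R : realType) (delta : R) (delta_gt : 1 / 2 < delta)
    (delta_le : delta <= 1) :
  exists C : R, 0 < C /\
    forall p : R, 1 <= p ->
    forall N : nat, exists n : nat, (N < n)%N /\
      exists M : finMetricType R, #|M| = n /\
        forall f : M -> {ffun nonempty_subset M -> R}, frechet_embedding f ->
        forall V : {set M}, n%:R `^ delta <= #|V|%:R ->
          (((C * ln n%:R) `^ p^-1)%:E
             <= distortion (@induced_dist R M V) (lp_dist p)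
                  (restriction f (V := V)))%E.
Proof.
(* With [n = 4^h] one has [n^delta = 2^h * 2^(a h)], where [2^h] is the number of stars and also of
   legs in each star. *)
pose a := 2 * delta - 1.
have a0 : 0 < a by rewrite /a; lra.
have ln2_gt0 : 0 < ln 2 :> R by rewrite ln_gt0// ltr1n.
have ln2_lt2 : ln 2 < 2 :> R by exact: ln_sublinear.
(* This makes the entropy loss [kap * h] half of the lower bound [(a h / 2) ln 2] for [ln #|S|]. *)
pose kap := a * ln 2 / 4.
have kap0 : 0 < kap by rewrite /kap divr_gt0// mulr_gt0.
have kap1 : kap < 1 by rewrite /kap /a; nra.
pose lam := 1 + ln kap^-1.
have lam0 : 0 < lam by rewrite /lam addr_gt0// ln_gt0// invf_gt1.
exists (kap / (8 * lam * ln 2)); split; first by rewrite divr_gt0// !mulr_gt0.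
move=> p p1 N.
have p0 : 0 < p by lra.
have [h0 h0P] : exists h0 : nat, 2 / a < h0%:R.
  by exists (Num.truncn (2 / a)).+1; exact: truncnS_gt.
pose h := (maxn N h0).+1.
have h_gt0 : (0 < h)%N by [].
have ah : 2 <= a * h%:R.
  rewrite mulrC -ler_pdivrMr// ltW// (lt_le_trans h0P)// ler_nat.
  by rewrite leqW// leq_maxr.
(* The map [x -> (1 - x) / (1 + x)] is a decreasing involution, so [gam <= (1 - t) / (1 + t)] keeps
   the fibre quotient at least [t], whose p-th power is [1 / 2]. Thus [gam] depends on [p], while
   the constant does not. *)
pose t : R := 2^-1 `^ p^-1.
have t0 : 0 < t by rewrite powR_gt0.
have t1 : t < 1.
  have := @gt0_ltr_powR R p^-1; rewrite invr_gt0 => /(_ p0 2^-1 1).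
  by rewrite powR1; apply; rewrite ?nnegrE ?invf_lt1 ?ltr1n ?invr_ge0.
pose gam := Num.min ((1 - t) / (1 + t)) (4 * h%:R)^-1.
have gam_gt0 : 0 < gam.
  rewrite lt_min divr_gt0 ?subr_gt0 ?addr_gt0//=.
  by rewrite invr_gt0 mulr_gt0// ltr0n.
have gam_small : 4 * h%:R * gam <= 1.
  rewrite mulrC -ler_pdivlMr ?mulr_gt0 ?ltr0n// div1r.
  by rewrite ge_min lexx orbT.
have gam_half : 2^-1 <= ((1 - gam) / (1 + gam)) `^ p.
  have -> : 2^-1 = t `^ p by rewrite /t -powRrM mulVf ?gt_eqF// powRr1.
  have t_le : t <= (1 - gam) / (1 + gam).
    have : gam <= (1 - t) / (1 + t) by rewrite ge_min lexx.
    rewrite ler_pdivlMr ?addr_gt0// ler_pdivlMr ?addr_gt0//; lra.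
  apply: ge0_ler_powR => //; rewrite ?nnegrE ?(ltW t0) ?(ltW p0)//.
  by apply: le_trans t_le; exact: ltW.
exists (2 ^ h * 2 ^ h)%N; split.
  rewrite (@leq_trans (2 ^ h))//; last by rewrite leq_pmulr// expn_gt0.
  by rewrite (leq_trans _ (ltnW (ltn_expl h _)))// ltnS leq_maxl.
exists (broom h gam_gt0 : finMetricType R); split; first exact: card_broom.
move=> f f_frechet V V_large.
have S_large : 2 `^ (a * h%:R) <= 1 + #|large_fibres V|%:R.
  pose H : R := (2 ^ h)%:R.
  have H0 : 0 < H by rewrite ltr0n expn_gt0.
  have HE : H = 2 `^ h%:R by rewrite powR_mulrn// -natrX.
  have nE : (2 ^ h * 2 ^ h)%:R `^ delta = H * 2 `^ (a * h%:R) :> R.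
    rewrite natrM -/H powRM ?(ltW H0)// HE -!powRrM.
    rewrite -!powRD ?pnatr_eq0 ?implybT//.
    by congr (_ `^ _); rewrite /a; ring.
  have : (#|V|)%:R <= H * (1 + #|large_fibres V|%:R).
    rewrite mulrDr mulr1 [H * _]mulrC -natrM -natrD ler_nat.
    exact: card_large_fibres.
  by move=> /(le_trans V_large); rewrite nE ler_pM2l.
(* With [x = 2^(a h / 2) >= 2], the bound [x^2 <= 1 + #|S|] gives [x <= #|S|]; the choice of [h]
   ensures [a h >= 2]. *)
have ln_S : a * h%:R / 2 * ln 2 <= ln #|large_fibres V|%:R.
  pose x : R := 2 `^ (a * h%:R / 2).
  have x2 : 2 <= x.
    by rewrite le1r_powR ?ler1n// ler_pdivlMr// mul1r.
  have xx : 2 `^ (a * h%:R) = x * x.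
    by rewrite -powRD ?pnatr_eq0 ?implybT// -splitr.
  have xS : x <= #|large_fibres V|%:R by rewrite xx in S_large; nra.
  by rewrite -ln_powR -/x ler_ln ?posrE; lra.
(* Since [ln n = 2 h ln 2], the constant is tuned so that [C * ln n] is the [k] with
   [lam * (4 k) = kap * h]. *)
have -> : kap / (8 * lam * ln 2) * ln (2 ^ h * 2 ^ h)%:R =
    kap * h%:R / (4 * lam).
  rewrite -expnD natrX lnXn// -[_ *+ (h + h)]mulr_natr natrD; field.
  by rewrite !gt_eqF.
have hR : 0 < h%:R :> R by rewrite ltr0n.
have kap_h : 2 * (kap * h%:R) <= ln #|large_fibres V|%:R.
  by apply: le_trans ln_S; rewrite /kap; lra.
have kap_h0 : 0 < kap * h%:R by rewrite mulr_gt0.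
apply: (broom_distortion_ge (gam_gt0 := gam_gt0) (h := h) (kap := kap)) => //.
- by rewrite kap0.
- by rewrite divr_ge0 ?ltW// mulr_gt0.
- lra.
- rewrite -/lam (_ : lam * _ = kap * h%:R); first lra.
  by field; rewrite gt_eqF.
Qed.
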